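(* Let $\Bbbk$ be a field and $\mathcal{C}$ a pivotal $\Bbbk$-category. Let $P$ be a projective object of $\mathcal{C}$ such that $\mathrm{ev}_P$ is an epimorphism, and let $t$ be a nonzero left ambidextrous trace on $\{P\}$. Let $\mathsf{t}$ be the unique left trace on $\mathrm{Proj}(\mathcal{C})$ with $\mathsf{t}_P=t$, let $\mathsf{d}(V)=\mathsf{t}_V(\mathrm{id}_V)$ for $V\in\mathrm{Proj}(\mathcal{C})$, and set $$\mathsf{A}=\{V\in\mathrm{Proj}(\mathcal{C})\mid V\text{ is simple and }\mathrm{ev}_V,\widetilde{\mathrm{ev}}_V\text{ are epimorphisms}\}.$$ Then the slope $s:\mathsf{A}\to\Bbbk^\times$, $s(V)=\mathsf{d}(V)/\mathsf{d}(V^* )$, has the following properties: (a) $s(V^* )=s(V)^{-1}$ for all $V\in\mathsf{A}$. (b) $s(U)=s(V)s(W)$ for all $U,V,W\in\mathsf{A}$ such that $U$ is a retract of $V\otimes W$. (c) For any $V\in\mathsf{A}$, $\mathsf{t}^\vee_V=\mathsf{t}_V$ if and only if $s(V)=1$.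
   Context: Pivotal categories. A pivotal category is a strict monoidal category $\mathcal{C}$ with unit $\mathbf{1}$ in which every object $X$ has a dual object $X^*$ and morphisms $\mathrm{ev}_X:X^*\otimes X\to\mathbf{1}$, $\mathrm{coev}_X:\mathbf{1}\to X\otimes X^*$, $\widetilde{\mathrm{ev}}_X:X\otimes X^*\to\mathbf{1}$, $\widetilde{\mathrm{coev}}_X:\mathbf{1}\to X^*\otimes X$ such that $(\mathrm{ev}_X,\mathrm{coev}_X)$ is a left duality, $(\widetilde{\mathrm{ev}}_X,\widetilde{\mathrm{coev}}_X)$ is a right duality, and the induced left and right dual functors coincide as monoidal functors; $f^*:Y^*\to X^*$ denotes the dual of $f:X\to Y$. The pivotal structure is the monoidal natural isomorphism $\phi_X=(\widetilde{\mathrm{ev}}_X\otimes\mathrm{id}_{X^{**}})(\mathrm{id}_X\otimes\mathrm{coev}_{X^*}):X\to X^{**}$. A pivotal $\Bbbk$-category is a pivotal category whose hom-sets are $\Bbbk$-modules, whose composition and monoidal product of morphisms are $\Bbbk$-bilinear, and such that $\mathrm{End}_{\mathcal C}(\mathbf{1})$ is a free $\Bbbk$-module of rank one. An object $X$ is simple if $\mathrm{End}_{\mathcal C}(X)$ is a free $\Bbbk$-module of rank one (equivalently $\Bbbk\to\mathrm{End}_{\mathcal C}(X)$, $k\mapsto k\,\mathrm{id}_X$, is an isomorphism). Partial traces. For $f\in\mathrm{Hom}_{\mathcal C}(X\otimes Y,X\otimes Z)$, $\mathrm{tr}_l^X(f)=(\mathrm{ev}_X\otimes\mathrm{id}_Z)(\mathrm{id}_{X^*}\otimes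 f)(\widetilde{\mathrm{coev}}_X\otimes\mathrm{id}_Y)\in\mathrm{Hom}_{\mathcal C}(Y,Z)$. For $g\in\mathrm{Hom}_{\mathcal C}(Y\otimes X,Z\otimes X)$, $\mathrm{tr}_r^X(g)=(\mathrm{id}_Z\otimes\widetilde{\mathrm{ev}}_X)(g\otimes\mathrm{id}_{X^*})(\mathrm{id}_Y\otimes\mathrm{coev}_X)\in\mathrm{Hom}_{\mathcal C}(Y,Z)$. Projectives. An object $P$ is projective if for any epimorphism $p:X\to Y$ and any $f:P\to Y$ in $\mathcal{C}$ there is $g:P\to X$ with $f=pg$; $\mathrm{Proj}(\mathcal{C})$ is the class of projective objects. An object $U$ is a retract of $X$ if there are $p:X\to U$, $q:U\to X$ with $pq=\mathrm{id}_U$. $\mathrm{Proj}(\mathcal{C})$ is closed under retracts, under duality, and under left and right tensor multiplication by objects of $\mathcal{C}$. Traces. A left trace on $\mathrm{Proj}(\mathcal{C})$ is a family of $\Bbbk$-linear forms $\mathsf{t}=\{\mathsf{t}_X:\mathrm{End}_{\mathcal C}(X)\to\Bbbk\}_{X\in\mathrm{Proj}(\mathcal{C})}$ such that $\mathsf{t}_V(gh)=\mathsf{t}_U(hg)$ for all $U,V\in\mathrm{Proj}(\mathcal{C})$, $g:U\to V$, $h:V\to U$, and $\mathsf{t}_{Y\otimes X}(f)=\mathsf{t}_X(\mathrm{tr}_l^Y(f))$ for all $X\in\mathrm{Proj}(\mathcal{C})$, $Y\in\mathcal{C}$, $f\in\mathrm{End}_{\mathcal C}(Y\otimes X)$. For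 $X\in\mathrm{Proj}(\mathcal{C})$ and $f\in\mathrm{End}_{\mathcal C}(X)$, $\mathsf{t}^\vee_X(f)=\mathsf{t}_{X^*}(f^* )$. A left ambidextrous trace on $\{P\}$ is a $\Bbbk$-linear form $t:\mathrm{End}_{\mathcal C}(P)\to\Bbbk$ such that $t(\phi_P^{-1}(\mathrm{tr}_l^{P}(f))^*\phi_P)=t(\mathrm{tr}_r^{P^*}(f))$ for all $f\in\mathrm{End}_{\mathcal C}(P\otimes P^* )$. Well-definedness facts used in the statement: since $\mathrm{ev}_P$ is an epimorphism, $\mathrm{Proj}(\mathcal{C})$ is the smallest left ideal containing $P$ (the class of retracts of objects $Y\otimes P$, $Y\in\mathcal{C}$), and $t$ extends uniquely to a left trace on $\mathrm{Proj}(\mathcal{C})$; $\mathsf{A}$ is closed under duality; and $\mathsf{d}(V)\neq0$ for all $V\in\mathsf{A}$. *)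

(* Defs.v *)
(* [boolp] is used only for proof irrelevance of equalities between objects. *)
From HB Require Import structures.
From mathcomp Require Import all_boot all_algebra boolp.

Set Implicit Arguments.
Unset Strict Implicit.
Unset Printing Implicit Defensive.

Import GRing.Theory.
Local Open Scope ring_scope.

Declare Scope cat_scope.
Delimit Scope cat_scope with cat.

Record category := Category {
  obj :> Type;
  mor : obj -> obj -> Type;
  idm : forall X, mor X X;
  comp : forall X Y Z, mor Y Z -> mor X Y -> mor X Z;
  comp1m : forall X Y (f : mor X Y), comp (idm Y) f = f;
  compm1 : forall X Y (f : mor X Y), comp f (idm X) = f;
  compA : forall W X Y Z (h : mor Y Z) (g : mor X Y) (f : mor W X),
    comp h (comp g f) = comp (comp h g) f }.

Arguments idm {c} X.

Notation "g ∘ f" := (comp g f)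
  (at level 40, left associativity) : cat_scope.
Local Open Scope cat_scope.

Definition epi (C : category) (X Y : C) (p : mor X Y) : Prop :=
  forall (Z : C) (a b : mor Y Z), a ∘ p = b ∘ p -> a = b.

Definition projective (C : category) (P : C) : Prop :=
  forall (X Y : C) (p : mor X Y) (f : mor P Y), epi p ->
  exists g : mor P X, f = p ∘ g.

Definition retract (C : category) (U X : C) : Prop :=
  exists (p : mor X U) (q : mor U X), p ∘ q = idm U.

(* In a strict monoidal category (X ⊗ Y) ⊗ Z and X ⊗ (Y ⊗ Z) are equal objects,
   but their hom-types are not convertible.  The identity of X = Y, seen as a
   morphism X -> Y, is written [idto e]; inserting such identities is the only
   way in which strictness shows up in formulas. *)
Definition idto (C : category) (X Y : C) (e : X = Y) : mor X Y :=
  match e in _ = Z return mor X Z with erefl => idm X end.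

Reserved Notation "X ⊗ Y" (at level 38, left associativity).
Reserved Notation "f ⊠ g" (at level 38, left associativity).

(* The last three axioms say that the functors -⊗(-⊗-) and (-⊗-)⊗-,
   1⊗- and id, -⊗1 and id, which agree on objects, also agree on morphisms. *)
Record strict_monoidal := StrictMonoidal {
  smc_cat :> category;
  tens : smc_cat -> smc_cat -> smc_cat;
  unit1 : smc_cat;
  tensm : forall X X' Y Y' : smc_cat,
    mor X X' -> mor Y Y' -> mor (tens X Y) (tens X' Y');
  tensm_id : forall X Y : smc_cat, tensm (idm X) (idm Y) = idm (tens X Y);
  tensm_comp : forall (X X' X'' Y Y' Y'' : smc_cat)
      (f' : mor X' X'') (f : mor X X') (g' : mor Y' Y'') (g : mor Y Y'),
    tensm (f' ∘ f) (g' ∘ g) = tensm f' g' ∘ tensm f g;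
  tensA : forall X Y Z, tens (tens X Y) Z = tens X (tens Y Z);
  tens1X : forall X, tens unit1 X = X;
  tensX1 : forall X, tens X unit1 = X;
  tensmA : forall (X X' Y Y' Z Z' : smc_cat)
      (f : mor X X') (g : mor Y Y') (h : mor Z Z'),
    idto (tensA X' Y' Z') ∘ tensm (tensm f g) h
    = tensm f (tensm g h) ∘ idto (tensA X Y Z);
  tens1m : forall (X X' : smc_cat) (f : mor X X'),
    idto (tens1X X') ∘ tensm (idm unit1) f = f ∘ idto (tens1X X);
  tensm1 : forall (X X' : smc_cat) (f : mor X X'),
    idto (tensX1 X') ∘ tensm f (idm unit1) = f ∘ idto (tensX1 X) }.

Arguments unit1 {s}.

Notation "X ⊗ Y" := (tens X Y) : cat_scope.
Notation "f ⊠ g" := (tensm f g) : cat_scope.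

Section Strict.
Variable C : strict_monoidal.
Implicit Types X Y Z A B : C.

Definition assoc X Y Z : mor ((X ⊗ Y) ⊗ Z) (X ⊗ (Y ⊗ Z)) :=
  idto (tensA X Y Z).
Definition assocV X Y Z : mor (X ⊗ (Y ⊗ Z)) ((X ⊗ Y) ⊗ Z) :=
  idto (esym (tensA X Y Z)).
Definition lunit X : mor (unit1 ⊗ X) X := idto (tens1X X).
Definition lunitV X : mor X (unit1 ⊗ X) := idto (esym (tens1X X)).
Definition runit X : mor (X ⊗ unit1) X := idto (tensX1 X).
Definition runitV X : mor X (X ⊗ unit1) := idto (esym (tensX1 X)).

(* c ⊗ id_Z and id_Z ⊗ c, for c : 1 -> A ⊗ B. *)
Definition cupl A B (c : mor unit1 (A ⊗ B)) Z : mor Z (A ⊗ (B ⊗ Z)) :=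
  assoc A B Z ∘ (c ⊠ idm Z) ∘ lunitV Z.
Definition cupr A B (c : mor unit1 (A ⊗ B)) Z : mor Z ((Z ⊗ A) ⊗ B) :=
  assocV Z A B ∘ (idm Z ⊠ c) ∘ runitV Z.

(* e ⊗ id_Z and id_Z ⊗ e, for e : A ⊗ B -> 1. *)
Definition capl A B (e : mor (A ⊗ B) unit1) Z : mor (A ⊗ (B ⊗ Z)) Z :=
  lunit Z ∘ (e ⊠ idm Z) ∘ assocV A B Z.
Definition capr A B (e : mor (A ⊗ B) unit1) Z : mor ((Z ⊗ A) ⊗ B) Z :=
  runit Z ∘ (idm Z ⊠ e) ∘ assoc Z A B.

End Strict.

Record duality_data (C : strict_monoidal) := DualityData {
  dual : C -> C;
  ev : forall X : C, mor (dual X ⊗ X) unit1;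
  coev : forall X : C, mor unit1 (X ⊗ dual X);
  evt : forall X : C, mor (X ⊗ dual X) unit1;
  coevt : forall X : C, mor unit1 (dual X ⊗ X) }.

Section DualFunctors.
Variables (C : strict_monoidal) (D : duality_data C).
Implicit Types X Y : C.
Local Notation "X ^*" := (dual D X) : cat_scope.

Definition left_duality : Prop := forall X,
  runit X ∘ (idm X ⊠ ev D X) ∘ cupl (coev D X) X = idm X /\
  lunit X^* ∘ (ev D X ⊠ idm X^*) ∘ cupr (coev D X) X^* = idm X^*.

Definition right_duality : Prop := forall X,
  lunit X ∘ (evt D X ⊠ idm X) ∘ cupr (coevt D X) X = idm X /\
  runit X^* ∘ (idm X^* ⊠ evt D X) ∘ cupl (coevt D X) X^* = idm X^*.

Definition dual_morL X Y (f : mor X Y) : mor Y^* X^* :=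
  lunit X^* ∘ (ev D Y ⊠ idm X^*) ∘ ((idm Y^* ⊠ f) ⊠ idm X^*)
    ∘ cupr (coev D X) Y^*.

Definition dual_morR X Y (f : mor X Y) : mor Y^* X^* :=
  runit X^* ∘ (idm X^* ⊠ evt D Y) ∘ (idm X^* ⊠ (f ⊠ idm Y^*))
    ∘ cupl (coevt D X) Y^*.

(* The nested evaluation (Y^* ⊗ X^* ) ⊗ (X ⊗ Y) -> 1 and its mirror image. *)
Definition ev2 X Y : mor ((Y^* ⊗ X^*) ⊗ (X ⊗ Y)) unit1 :=
  ev D Y ∘ (idm Y^* ⊠ capl (ev D X) Y) ∘ assoc Y^* X^* (X ⊗ Y).

Definition evt2 X Y : mor ((X ⊗ Y) ⊗ (Y^* ⊗ X^*)) unit1 :=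
  evt D X ∘ (idm X ⊠ capl (evt D Y) X^*) ∘ assoc X Y (Y^* ⊗ X^*).

(* Monoidal constraints of the two (contravariant) dual functors. *)
Definition dual_multL X Y : mor (Y^* ⊗ X^*) (X ⊗ Y)^* :=
  lunit (X ⊗ Y)^* ∘ (ev2 X Y ⊠ idm (X ⊗ Y)^*)
    ∘ cupr (coev D (X ⊗ Y)) (Y^* ⊗ X^*).

Definition dual_multR X Y : mor (Y^* ⊗ X^*) (X ⊗ Y)^* :=
  runit (X ⊗ Y)^* ∘ (idm (X ⊗ Y)^* ⊠ evt2 X Y)
    ∘ cupl (coevt D (X ⊗ Y)) (Y^* ⊗ X^*).

Definition dual_unitL : mor unit1 unit1^* := lunit unit1^* ∘ coev D unit1.

Definition dual_unitR : mor unit1 unit1^* := runit unit1^* ∘ coevt D unit1.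

Definition same_dual_functors : Prop :=
  [/\ forall X Y (f : mor X Y), dual_morL f = dual_morR f,
      forall X Y, dual_multL X Y = dual_multR X Y
    & dual_unitL = dual_unitR].

End DualFunctors.

Record pivotal_category := PivotalCategory {
  piv_smc :> strict_monoidal;
  piv_dual : duality_data piv_smc;
  pivL : left_duality piv_dual;
  pivR : right_duality piv_dual;
  pivLR : same_dual_functors piv_dual }.

Notation "X ^*" := (dual (piv_dual _) X) : cat_scope.

Section Pivotal.
Variable C : pivotal_category.
Implicit Types X Y Z : C.

Definition pev X : mor (X^* ⊗ X) unit1 := ev (piv_dual C) X.
Definition pcoev X : mor unit1 (X ⊗ X^*) := coev (piv_dual C) X.
Definition pevt X : mor (X ⊗ X^*) unit1 := evt (piv_dual C) X.
Definition pcoevt X : mor unit1 (X^* ⊗ X) := coevt (piv_dual C) X.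

Definition dual_mor X Y (f : mor X Y) : mor Y^* X^* :=
  dual_morL (piv_dual C) f.

Definition phi X : mor X X^*^* :=
  lunit X^*^* ∘ (pevt X ⊠ idm X^*^*) ∘ cupr (pcoev X^*) X.

(* The inverse of phi; see [phiK] and [phiVK]. *)
Definition phiV X : mor X^*^* X :=
  lunit X ∘ (pev X^* ⊠ idm X) ∘ cupr (pcoevt X) X^*^*.

Definition ptrl X Y Z (f : mor (X ⊗ Y) (X ⊗ Z)) : mor Y Z :=
  capl (pev X) Z ∘ (idm X^* ⊠ f) ∘ cupl (pcoevt X) Y.

Definition ptrr X Y Z (g : mor (Y ⊗ X) (Z ⊗ X)) : mor Y Z :=
  capr (pevt X) Z ∘ (g ⊠ idm X^*) ∘ cupr (pcoev X) Y.

End Pivotal.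

Section Coherence.
Variable C : strict_monoidal.
Implicit Types X Y Z W A B L : C.

Lemma idto_irr X Y (e e' : X = Y) : idto e = idto e'.
Proof. by rewrite (Prop_irrelevance e e'). Qed.

Lemma idto_id X (e : X = X) : idto e = idm X.
Proof. by rewrite (Prop_irrelevance e erefl). Qed.

Lemma idto_comp X Y Z (e : X = Y) (e' : Y = Z) :
  idto e' ∘ idto e = idto (etrans e e').
Proof. by subst Z; apply: comp1m. Qed.

Lemma idto_tens X X' Y Y' (e : X = X') (e' : Y = Y') :
  idto e ⊠ idto e' = idto (f_equal2 (@tens C) e e').
Proof. by subst X' Y'; rewrite tensm_id idto_id. Qed.

Lemma idto_tensl X X' Y (e : X = X') :
  idto e ⊠ idm Y = idto (f_equal (fun T => tens T Y) e).
Proof. by subst X'; apply: tensm_id. Qed.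

Lemma idto_tensr X Y Y' (e : Y = Y') :
  idm X ⊠ idto e = idto (f_equal (tens X) e).
Proof. by subst Y'; apply: tensm_id. Qed.

Lemma assocK X Y Z : assocV X Y Z ∘ assoc X Y Z = idm _.
Proof. by rewrite idto_comp idto_id. Qed.

Lemma assocVK X Y Z : assoc X Y Z ∘ assocV X Y Z = idm _.
Proof. by rewrite idto_comp idto_id. Qed.

Lemma lunitK X : lunitV X ∘ lunit X = idm _.
Proof. by rewrite idto_comp idto_id. Qed.

Lemma lunitVK X : lunit X ∘ lunitV X = idm _.
Proof. by rewrite idto_comp idto_id. Qed.

Lemma runitK X : runitV X ∘ runit X = idm _.
Proof. by rewrite idto_comp idto_id. Qed.

Lemma runitVK X : runit X ∘ runitV X = idm _.
Proof. by rewrite idto_comp idto_id. Qed.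

Lemma assocV_nat X X' Y Y' Z Z' (f : mor X X') (g : mor Y Y') (h : mor Z Z') :
  assocV X' Y' Z' ∘ (f ⊠ (g ⊠ h)) = ((f ⊠ g) ⊠ h) ∘ assocV X Y Z.
Proof.
rewrite -[LHS]compm1 -(assocVK X Y Z) compA -(compA (assocV _ _ _)) -tensmA.
by rewrite !compA -/(assoc X' Y' Z') assocK comp1m.
Qed.

Lemma lunitV_nat X X' (f : mor X X') :
  lunitV X' ∘ f = (idm unit1 ⊠ f) ∘ lunitV X.
Proof.
rewrite -[LHS]compm1 -(lunitVK X) compA -(compA (lunitV _)) -tens1m.
by rewrite !compA -/(lunit X') lunitK comp1m.
Qed.

Lemma runitV_nat X X' (f : mor X X') :
  runitV X' ∘ f = (f ⊠ idm unit1) ∘ runitV X.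
Proof.
rewrite -[LHS]compm1 -(runitVK X) compA -(compA (runitV _)) -tensm1.
by rewrite !compA -/(runit X') runitK comp1m.
Qed.

Lemma tensm_compl X X' X'' Y (f' : mor X' X'') (f : mor X X') :
  (f' ∘ f) ⊠ idm Y = (f' ⊠ idm Y) ∘ (f ⊠ idm Y).
Proof. by rewrite -tensm_comp comp1m. Qed.

Lemma tensm_compr X Y Y' Y'' (f' : mor Y' Y'') (f : mor Y Y') :
  idm X ⊠ (f' ∘ f) = (idm X ⊠ f') ∘ (idm X ⊠ f).
Proof. by rewrite -tensm_comp comp1m. Qed.

Lemma tensm_swap X X' Y Y' (f : mor X X') (g : mor Y Y') :
  (f ⊠ idm Y') ∘ (idm X ⊠ g) = (idm X' ⊠ g) ∘ (f ⊠ idm Y).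
Proof. by rewrite -!tensm_comp !comp1m !compm1. Qed.

Lemma cupr_nat A B (c : mor unit1 (A ⊗ B)) Z Z' (g : mor Z Z') :
  cupr c Z' ∘ g = ((g ⊠ idm A) ⊠ idm B) ∘ cupr c Z.
Proof.
rewrite /cupr -!compA runitV_nat !compA; congr (_ ∘ _).
by rewrite -assocV_nat tensm_id -!compA tensm_swap.
Qed.

(* The comparison morphism between two left duals L and L' of B. *)
Definition mate L B L' (e : mor (L ⊗ B) unit1) (c' : mor unit1 (B ⊗ L')) :
    mor L L' :=
  lunit L' ∘ (e ⊠ idm L') ∘ cupr c' L.

Lemma mate_comp L B L' L'' (e' : mor (L' ⊗ B) unit1)
    (c : mor unit1 (B ⊗ L'')) (g : mor L L') :
  mate e' c ∘ g = mate (e' ∘ (g ⊠ idm B)) c.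
Proof.
by rewrite /mate tensm_compl -compA cupr_nat !compA.
Qed.

Lemma mate_ev L B L' (e : mor (L ⊗ B) unit1) (c' : mor unit1 (B ⊗ L'))
    (e' : mor (L' ⊗ B) unit1) :
  runit B ∘ (idm B ⊠ e') ∘ cupl c' B = idm B ->
  e' ∘ (mate e c' ⊠ idm B) = e.
Proof.
move=> zig.
have lunA : lunit L' ⊠ idm B = lunit (L' ⊗ B) ∘ assoc unit1 L' B.
  by rewrite idto_tensl idto_comp; apply: idto_irr.
have lr1 : lunit unit1 = runit unit1 :> mor (unit1 ⊗ unit1 : C) _.
  exact: (idto_irr (tens1X unit1) (tensX1 unit1)).
have idLB : (idm L ⊠ runit B) ∘ (idm L ⊠ (idm B ⊠ e')) ∘ (idm L ⊠ cupl c' B)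
    = idm (L ⊗ B).
  by rewrite -!tensm_compr zig tensm_id.
rewrite -[RHS]compm1 -idLB /mate !tensm_compl lunA !compA.
rewrite -tens1m -/(lunit unit1).
rewrite -(compA _ (assoc unit1 L' B)) tensmA tensm_id.
rewrite compA -(compA (lunit unit1)) -tensm_swap compA lr1 tensm1.
rewrite -/(runit _) -!compA; congr (e ∘ _).
have runA : idm L ⊠ runit B = runit (L ⊗ B) ∘ assocV L B unit1.
  by rewrite idto_tensr idto_comp; apply: idto_irr.
rewrite runA -compA; congr (runit _ ∘ _).
rewrite [RHS]compA assocV_nat tensm_id -compA; congr (_ ∘ _).
have -> : (idm L ⊠ c') ⊠ idm B
    = assocV L (B ⊗ L') B ∘ (idm L ⊠ (c' ⊠ idm B)) ∘ assoc L unit1 B.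
  by rewrite assocV_nat -compA assocK compm1.
have lunV : assoc L unit1 B ∘ (runitV L ⊠ idm B) = idm L ⊠ lunitV B.
  by rewrite idto_tensl idto_tensr idto_comp; apply: idto_irr.
rewrite -!compA lunV /cupl !tensm_compr !compA; congr (_ ∘ _ ∘ _).
by rewrite idto_tensl idto_tensr !idto_comp; apply: idto_irr.
Qed.

End Coherence.

Section PhiInverse.
Variables (C : pivotal_category) (X : C).

Lemma phiK : phiV X ∘ phi X = idm X.
Proof.
rewrite -[phiV X]/(mate (pev X^*) (pcoevt X)) mate_comp.
by rewrite mate_ev ?(proj1 (pivL X^*)) //; apply: (proj1 (pivR X)).
Qed.

Lemma phiVK : phi X ∘ phiV X = idm X^*^*.
Proof.
rewrite -[phi X]/(mate (pevt X) (pcoev X^*)) mate_comp.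
by rewrite mate_ev ?(proj2 (pivR X)) //; apply: (proj2 (pivL X^*)).
Qed.

End PhiInverse.

Definition free_rank_one (k : nzRingType) (M : lmodType k) : Prop :=
  exists e : M, forall m : M, exists! a : k, m = a *: e.

(* A pivotal category whose hom-sets are k-modules, with no compatibility
   required yet between the two structures. *)
Record module_pivotal (k : fieldType) := ModulePivotal {
  mp_piv :> pivotal_category;
  mp_lmod : forall X Y : mp_piv, GRing.Lmodule k (mor X Y) }.

HB.instance Definition _ (k : fieldType) (C : module_pivotal k) (X Y : C) :=
  mp_lmod X Y.

Record pivotal_kcategory (k : fieldType) := PivotalKCategory {
  pk_mp :> module_pivotal k;
  comp_linl : forall (X Y Z : pk_mp) (f : mor X Y),
    linear (fun g : mor Y Z => g ∘ f);
  comp_linr : forall (X Y Z : pk_mp) (g : mor Y Z),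
    linear (fun f : mor X Y => g ∘ f);
  tensm_linl : forall (X X' Y Y' : pk_mp) (g : mor Y Y'),
    linear (fun f : mor X X' => f ⊠ g);
  tensm_linr : forall (X X' Y Y' : pk_mp) (f : mor X X'),
    linear (fun g : mor Y Y' => f ⊠ g);
  end_unit1 : free_rank_one (mor (unit1 : pk_mp) unit1) }.

Section Traces.
Variables (k : fieldType) (C : pivotal_kcategory k).
Implicit Types P U V X Y : C.

Definition simple X : Prop := free_rank_one (mor X X).

(* A family of linear forms indexed by the projective objects is encoded by a
   family indexed by all objects; its values at the non-projective ones are
   irrelevant, since nothing below constrains or uses them. *)
Definition left_trace (tr : forall X, {scalar mor X X}) : Prop :=
  (forall U V, projective U -> projective V ->
     forall (g : mor U V) (h : mor V U), tr V (g ∘ h) = tr U (h ∘ g)) /\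
  (forall X Y, projective X ->
     forall f : mor (Y ⊗ X) (Y ⊗ X), tr (Y ⊗ X) f = tr X (ptrl f)).

Definition left_ambidextrous P (t : {scalar mor P P}) : Prop :=
  forall f : mor (P ⊗ P^*) (P ⊗ P^*),
    t (phiV P ∘ dual_mor (ptrl f) ∘ phi P) = t (ptrr f).

Definition class_A V : Prop :=
  [/\ projective V, simple V, epi (pev V) & epi (pevt V)].

Variable tr : forall X, {scalar mor X X}.

Definition mdim V : k := tr V (idm V).

Definition slope V : k := mdim V / mdim V^*.

Definition dual_trace V (f : mor V V) : k := tr V^* (dual_mor f).

End Traces.

(* Main.v *)
From mathcomp Require Import all_boot all_algebra boolp ring.
Require Import Defs.

(** Write d(V) for the value of the trace at the identity of V.  Parts (a) and (c)
    are immediate once d does not vanish on simple objects of the class A: the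
    dual of a*id is a*id, and V is isomorphic to its double dual.  For the
    nonvanishing, P is a retract of an object Y ⊗ V because ev_V is an epimorphism,
    so the left trace property writes every value of t as a multiple of d(V)
    ([mdim_neq0]).

    Part (b) rests on one identity, which holds for all projective X and Y and all
    endomorphisms f of X ⊗ Y ([exchange_projective]): the trace on X of the right
    partial trace of f equals the dual trace on Y of the left partial trace of f.
    For X = P and Y = P^* this is ambidexterity.  It passes from X to A ⊗ X, since
    the trace is a left trace, from Y to Y ⊗ B, since the dual trace is a right
    trace, and to retracts, since both are cyclic; and any projective X and Y are
    reached from P and P^* in this way because ev_P is an epimorphism.  If U is a
    retract of V ⊗ W, with idempotent e, then by simplicity the partial traces of
    e are scalars, and comparing the ways to evaluate the traces of e gives
    s(U) = s(V) s(W) ([slope_tens]).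

    The facts about partial traces used here (cyclicity [ptrl_cyclic],
    multiplicativity [ptrl_tens], compatibility with duality [ptrl_dual]) are
    string diagram computations.  To be free of the identity morphisms that
    express strictness they are carried out in an untyped calculus of arrows, in
    which the tensor product is associative and unital on the nose.  The least
    formal of them is [phi_evt], a consequence of the equality of the left and
    right dual functors as monoidal functors.  The versions for right partial
    traces come from the mirror category. *)

Set Implicit Arguments.
Unset Strict Implicit.
Unset Printing Implicit Defensive.

Import GRing.Theory.
Local Open Scope ring_scope.
Local Open Scope cat_scope.

(** * An untyped calculus of string diagrams *)

(** An arrow is a morphism with its source and target forgotten in its type, with
    one extra arrow without morphism between any two objects.  The total
    composition [acomp] returns that zero arrow on non-composable pairs, so that
    its source and target are always those expected and associativity holds
    without side conditions. *)
Record arrow (C : category) :=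
  Arrow { dom : C; cod : C; hom : option (mor dom cod) }.

Definition tot (C : category) (X Y : C) (f : mor X Y) : arrow C :=
  Arrow (Some f).
Coercion tot : mor >-> arrow.

(** Objects are used as identity arrows: [X ⊠ f] is the whiskering of [f] by [X]. *)
Definition ida (C : category) (X : C) : arrow C := tot (idm X).
Coercion ida : obj >-> arrow.

Declare Scope arr_scope.
Delimit Scope arr_scope with arr.
Bind Scope arr_scope with arrow.

Definition acomp (C : category) (g f : arrow C) : arrow C :=
  @Arrow C (dom f) (cod g)
    match pselect (cod f = dom g), hom f, hom g with
    | left e, Some f', Some g' => Some (g' ∘ idto e ∘ f')
    | _, _, _ => None
    end.

Definition aten (C : strict_monoidal) (f g : arrow C) : arrow C :=
  @Arrow C (dom f ⊗ dom g) (cod f ⊗ cod g)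
    match hom f, hom g with
    | Some f', Some g' => Some (f' ⊠ g')
    | _, _ => None
    end.

Notation "g ∘ f" := (acomp g f) : arr_scope.
Notation "f ⊠ g" := (aten f g) : arr_scope.

Section Arrows.
Variable C : category.
Implicit Types (X Y Z : C) (f g h : arrow C).

Lemma idto_refl X (e : X = X) : idto e = idm X.
Proof. by rewrite (Prop_irrelevance e erefl). Qed.

Lemma hom_eq f g (eD : dom f = dom g) (eC : cod f = cod g) : f = g ->
  omap (fun u => idto eC ∘ u) (hom f) = omap (fun v => v ∘ idto eD) (hom g).
Proof.
move=> e; subst g; case: f eD eC => X Y [u|] //= eD eC.
by rewrite !idto_refl comp1m compm1.
Qed.

(** Since equality proofs between objects are unique, nothing is lost in passing
    to arrows: an equation of morphisms may be proved in the untyped calculus. *)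
Lemma tot_inj X Y (f g : mor X Y) : tot f = tot g -> f = g.
Proof.
by move/(@hom_eq f g erefl erefl) => /=; rewrite comp1m compm1 => -[].
Qed.

Lemma tot_idto X Y (e : X = Y) : tot (idto e) = X.
Proof. by subst Y. Qed.

Lemma tot_idto' X Y (e : X = Y) : tot (idto e) = Y.
Proof. by subst Y. Qed.

Lemma tot_comp X Y Z (g : mor Y Z) (f : mor X Y) :
  tot (g ∘ f) = (tot g ∘ tot f)%arr.
Proof.
rewrite /acomp /=; case: pselect => [e|//].
by rewrite idto_refl compm1.
Qed.

Lemma acompA h g f : (h ∘ (g ∘ f) = h ∘ g ∘ f)%arr.
Proof.
case: h g f => [X3 Y3 h] [X2 Y2 g] [X1 Y1 f]; rewrite /acomp /=.
case: pselect => [e1|n1]; case: pselect => [e2|n2] //;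
  case: f g h => [f|] [g|] [h|] //.
by congr Arrow; congr Some; rewrite !compA.
Qed.

Lemma acomp1 X f : X = cod f -> (X ∘ f = f)%arr.
Proof.
case: f => [X1 Y1 f] /= ->; rewrite /acomp /=.
by case: pselect => // e; case: f => [f|] //; rewrite idto_refl !comp1m.
Qed.

Lemma acompr1 X f : X = dom f -> (f ∘ X = f)%arr.
Proof.
case: f => [X1 Y1 f] /= ->; rewrite /acomp /=.
by case: pselect => // e; case: f => [f|] //; rewrite idto_refl !compm1.
Qed.

End Arrows.

Section Tensor.
Variable C : strict_monoidal.
Implicit Types (X Y Z : C) (f g h : arrow C).

Lemma tot_tens X X' Y Y' (f : mor X X') (g : mor Y Y') :
  tot (f ⊠ g) = (tot f ⊠ tot g)%arr.
Proof. by []. Qed.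

Lemma ida_tens X Y : ida (X ⊗ Y) = (X ⊠ Y)%arr.
Proof. by rewrite -tot_tens tensm_id. Qed.

Lemma eq_arrow X Y X' Y' (f : mor X Y) (f' : mor X' Y')
    (e : X = X') (e' : Y = Y') :
  idto e' ∘ f = f' ∘ idto e -> tot f = tot f'.
Proof. by subst X' Y'; rewrite /= comp1m compm1 => ->. Qed.

Lemma zero_arrow X Y X' Y' : X = X' -> Y = Y' ->
  @Arrow C X Y None = Arrow (None : option (mor X' Y')).
Proof. by move=> -> ->. Qed.

(** The point of the untyped calculus: [⊠] is associative and unital on the nose,
    so that no associator or unitor has to be moved around. *)
Lemma atenA f g h : (f ⊠ g ⊠ h = f ⊠ (g ⊠ h))%arr.
Proof.
case: f g h => [X1 Y1 [f|]] [X2 Y2 [g|]] [X3 Y3 [h|]]; rewrite /aten /=;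
  try by apply: zero_arrow; rewrite tensA.
exact: eq_arrow (tensmA f g h).
Qed.

Lemma aten1 f : ((unit1 : C) ⊠ f = f)%arr.
Proof.
case: f => [X Y [f|]]; rewrite /aten /=; last by apply: zero_arrow; rewrite tens1X.
exact: eq_arrow (tens1m f).
Qed.

Lemma atenr1 f : (f ⊠ (unit1 : C) = f)%arr.
Proof.
case: f => [X Y [f|]]; rewrite /aten /=; last by apply: zero_arrow; rewrite tensX1.
exact: eq_arrow (tensm1 f).
Qed.

Lemma interchange f' f g' g : cod f = dom f' -> cod g = dom g' ->
  ((f' ⊠ g') ∘ (f ⊠ g) = (f' ∘ f) ⊠ (g' ∘ g))%arr.
Proof.
case: f f' g g' => [X1 Y1 f] [X1' Y1' f'] [X2 Y2 g] [X2' Y2' g'] /= e1 e2.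
subst X1' X2'; rewrite /acomp /aten /=.
do 3 (case: pselect => // ?).
case: f f' g g' => [f|] [f'|] [g|] [g'|] //.
by rewrite !idto_refl !compm1 tensm_comp.
Qed.

End Tensor.

(* Strictness closes the equalities of objects that the laws below leave. *)
Ltac objs := by rewrite /= ?tensA ?tens1X ?tensX1.

Section Calculus.
Variable C : strict_monoidal.
Implicit Types (X Y Z A B : C) (f g h : arrow C).

Lemma tot_idl X Y Z (e : Y = Z) (f : mor X Y) : tot (idto e ∘ f) = tot f.
Proof. by rewrite tot_comp tot_idto acomp1. Qed.

Lemma tot_idr X Y Z (e : X = Y) (f : mor Y Z) : tot (f ∘ idto e) = tot f.
Proof. by rewrite tot_comp tot_idto' acompr1. Qed.

Lemma tot_cupl A B (c : mor unit1 (A ⊗ B)) Z :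
  tot (cupl c Z) = (c ⊠ Z)%arr.
Proof. by rewrite /cupl /assoc /lunitV tot_idr tot_idl. Qed.

Lemma tot_cupr A B (c : mor unit1 (A ⊗ B)) Z :
  tot (cupr c Z) = (Z ⊠ c)%arr.
Proof. by rewrite /cupr tot_idr tot_idl. Qed.

Lemma tot_capl A B (e : mor (A ⊗ B) unit1) Z :
  tot (capl e Z) = (e ⊠ Z)%arr.
Proof. by rewrite /capl tot_idr tot_idl. Qed.

Lemma tot_capr A B (e : mor (A ⊗ B) unit1) Z :
  tot (capr e Z) = (Z ⊠ e)%arr.
Proof. by rewrite /capr tot_idr tot_idl. Qed.

Lemma whiskerl X g f : cod f = dom g ->
  (X ⊠ (g ∘ f) = (X ⊠ g) ∘ (X ⊠ f))%arr.
Proof. by move=> e; rewrite interchange // acomp1. Qed.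

Lemma whiskerr X g f : cod f = dom g ->
  ((g ∘ f) ⊠ X = (g ⊠ X) ∘ (f ⊠ X))%arr.
Proof. by move=> e; rewrite interchange // acomp1. Qed.

(** Two diagrams side by side may be evaluated in either order; [f ⊠ g] is the
    common value, and a pair [slidel], [slider] slides [f] past [g]. *)
Lemma slidel f g X Y : X = cod f -> Y = dom g ->
  ((X ⊠ g) ∘ (f ⊠ Y) = f ⊠ g)%arr.
Proof. by move=> -> ->; rewrite interchange // acomp1 // acompr1. Qed.

Lemma slider f g X Y : X = dom f -> Y = cod g ->
  ((f ⊠ Y) ∘ (X ⊠ g) = f ⊠ g)%arr.
Proof. by move=> -> ->; rewrite interchange // acomp1 // acompr1. Qed.

(** The same sliding laws when the source or the target of one of the two
    diagrams is the unit, so that its strands appear or disappear. *)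
Lemma aten_cupr f g X : dom g = unit1 -> X = cod f ->
  ((X ⊠ g) ∘ f = f ⊠ g)%arr.
Proof. by move=> eg ef; rewrite -{1}(atenr1 f) slidel. Qed.

Lemma aten_cupl f g X : dom f = unit1 -> X = cod g ->
  ((f ⊠ X) ∘ g = f ⊠ g)%arr.
Proof. by move=> eg ef; rewrite -{1}(aten1 g) slider. Qed.

Lemma aten_capr f g X : cod g = unit1 -> X = dom f ->
  (f ∘ (X ⊠ g) = f ⊠ g)%arr.
Proof. by move=> eg ef; rewrite -{1}(atenr1 f) slider. Qed.

Lemma aten_capl f g X : cod f = unit1 -> X = dom g ->
  (g ∘ (f ⊠ X) = f ⊠ g)%arr.
Proof. by move=> eg ef; rewrite -{1}(aten1 g) slidel. Qed.

Lemma aten_through f g : dom f = unit1 -> cod g = unit1 -> (f ⊠ g = f ∘ g)%arr.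
Proof.
by move=> df cg; rewrite -(@slider f g (dom f) (cod g)) // df cg aten1 atenr1.
Qed.

Lemma aten_through_rev f g : cod f = unit1 -> dom g = unit1 ->
  (f ⊠ g = g ∘ f)%arr.
Proof.
by move=> cf dg; rewrite -(@slidel f g (cod f) (dom g)) // cf dg aten1 atenr1.
Qed.

(** [B] is left dual to [A]: both zigzags of the cap [e] and the cup [c] can be
    pulled straight.  An object [X] of a pivotal category gives two instances,
    one for each of its two dualities. *)
Definition adjoint A B (e : mor (B ⊗ A) unit1) (c : mor unit1 (A ⊗ B)) :=
  ((A ⊠ e) ∘ (c ⊠ A) = A /\ (e ⊠ B) ∘ (B ⊠ c) = B)%arr.

Lemma bendl A B e c Z (x : mor Z B) : @adjoint A B e c ->
  (((e ∘ (x ⊠ A)) ⊠ B) ∘ (Z ⊠ c) = x)%arr.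
Proof.
move=> [_ zig]; rewrite whiskerr // -acompA atenA -ida_tens slider //.
by rewrite -(@slidel x c B unit1) // acompA zig atenr1 acomp1.
Qed.

(** Bending a strand down and back up again changes nothing. *)
Lemma unbendl A B e c Z W g : @adjoint A B e c ->
  dom g = Z ⊗ A -> cod g = W ->
  ((W ⊠ e) ∘ (((g ⊠ B) ∘ (Z ⊠ c)) ⊠ A) = g)%arr.
Proof.
move=> [zag _] dg cg.
rewrite whiskerr; last by rewrite /= dg; objs.
rewrite acompA atenA -ida_tens slidel // -(@slider g e (Z ⊗ A) unit1) //.
rewrite atenr1 ida_tens -acompA !atenA -whiskerl; last by objs.
by rewrite zag -ida_tens acompr1.
Qed.

Lemma unbendr A B e c Z W g : @adjoint A B e c ->
  dom g = B ⊗ Z -> cod g = W ->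
  ((e ⊠ W) ∘ (B ⊠ ((A ⊠ g) ∘ (c ⊠ Z))) = g)%arr.
Proof.
move=> [_ zig] dg cg.
rewrite whiskerl; last by rewrite /= dg; objs.
rewrite acompA -atenA -ida_tens slider // -(@slidel e g unit1 (B ⊗ Z)) //.
rewrite aten1 ida_tens -acompA -!atenA -whiskerr; last by objs.
by rewrite zig -ida_tens acompr1.
Qed.

Lemma cap_inj A B e c Z (a b : mor Z B) : @adjoint A B e c ->
  (e ∘ (a ⊠ A) = e ∘ (b ⊠ A))%arr -> a = b.
Proof.
by move=> adj eq_ab; apply: tot_inj; rewrite -(bendl a adj) eq_ab bendl.
Qed.

(** Two morphisms that are conjugate with respect to the caps are conjugate with
    respect to the cups.  When the left and right dual functors agree, this lets a
    dual computed with one duality be slid along the cups of the other. *)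
Lemma conj_cups A B A' B' e c e' c' (h : mor A A') (k : mor B' B) :
  @adjoint A B e c -> @adjoint A' B' e' c' ->
  (e ∘ (k ⊠ A) = e' ∘ (B' ⊠ h) -> (A' ⊠ k) ∘ c' = (h ⊠ B) ∘ c)%arr.
Proof.
move=> adj [zag' _] eq_caps.
rewrite -(bendl k adj) eq_caps whiskerl; last by objs.
rewrite -acompA -!atenA -ida_tens aten_cupr //.
rewrite !whiskerl // whiskerr; last by objs.
rewrite -acompA -!atenA -(ida_tens A' B') (atenA _ h) interchange //.
rewrite acomp1 // -(aten_cupl (f := c') (X := A' ⊗ B)) //.
by rewrite ida_tens -atenA acompA -whiskerr ?zag' -?ida_tens ?acomp1 //; objs.
Qed.

(** The nested cap and cup make [B' ⊗ B] dual to [A ⊗ A']: inside each zigzag, the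
    inner cap slides off the inner cup, which leaves two separate zigzags. *)
Lemma adjoint_comp A B A' B' e c e' c' e2 c2 :
  @adjoint A B e c -> @adjoint A' B' e' c' ->
  tot e2 = (e' ∘ (B' ⊠ e ⊠ A'))%arr -> tot c2 = ((A ⊠ c' ⊠ B) ∘ c)%arr ->
  @adjoint (A ⊗ A') (B' ⊗ B) e2 c2.
Proof.
move=> [zagA zigA] [zagA' zigA'] E2 C2.
have swap : (((A' ⊠ B') ⊠ e) ∘ (c' ⊠ (B ⊠ A)) = c' ∘ e)%arr.
  by rewrite -!ida_tens slidel // aten_through.
have swap' : ((e ⊠ (A' ⊠ B')) ∘ ((B ⊠ A) ⊠ c') = c' ∘ e)%arr.
  by rewrite -!ida_tens slider // aten_through_rev.
split.
  rewrite E2 C2 whiskerl; last by objs.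
  rewrite whiskerr; last by objs.
  transitivity ((A ⊠ A' ⊠ e') ∘ (A ⊠ ((A' ⊠ B' ⊠ e) ∘ (c' ⊠ (B ⊠ A))) ⊠ A')
                 ∘ (c ⊠ A ⊠ A'))%arr.
    rewrite whiskerl; last by objs.
    rewrite whiskerr; last by objs.
    by rewrite !ida_tens !acompA !atenA.
  rewrite swap whiskerl // whiskerr // -!acompA -whiskerr; last by objs.
  rewrite zagA -(ida_tens A A') acompr1; last by objs.
  by rewrite ida_tens !atenA -whiskerl ?zagA' //; objs.
rewrite E2 C2 whiskerl; last by objs.
rewrite whiskerr; last by objs.
transitivity ((e' ⊠ B' ⊠ B) ∘ (B' ⊠ ((e ⊠ (A' ⊠ B')) ∘ (B ⊠ A ⊠ c')) ⊠ B)
               ∘ (B' ⊠ B ⊠ c))%arr.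
  rewrite whiskerl; last by objs.
  rewrite whiskerr; last by objs.
  by rewrite !ida_tens !acompA !atenA.
rewrite swap' whiskerl // whiskerr // !acompA -whiskerr; last by objs.
rewrite zigA' -(ida_tens B' B) acomp1; last by objs.
by rewrite ida_tens !atenA -whiskerl ?zigA //; objs.
Qed.

Lemma mate_cap B L L' (e : mor (L ⊗ B) unit1) (e' : mor (L' ⊗ B) unit1)
    (c' : mor unit1 (B ⊗ L')) :
  adjoint e' c' -> (e' ∘ (mate e c' ⊠ B) = e)%arr.
Proof.
move=> [zag _]; rewrite -tot_tens -tot_comp mate_ev //.
by apply: tot_inj; rewrite -compA tot_idl tot_comp tot_tens tot_cupl.
Qed.

End Calculus.

(** * Partial traces in a pivotal category *)

Section PivotalCalculus.
Variable C : pivotal_category.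
Implicit Types X Y Z A B : C.

Lemma adjointL X : adjoint (pev X) (pcoev X).
Proof.
have [/(congr1 (@tot _ _ _)) h1 /(congr1 (@tot _ _ _)) h2] := pivL X; split.
  by move: h1; rewrite -compA tot_idl tot_comp tot_tens tot_cupl.
by move: h2; rewrite -compA tot_idl tot_comp tot_tens tot_cupr.
Qed.

Lemma adjointR X : adjoint (pevt X) (pcoevt X).
Proof.
have [/(congr1 (@tot _ _ _)) h1 /(congr1 (@tot _ _ _)) h2] := pivR X; split.
  by move: h2; rewrite -compA tot_idl tot_comp tot_tens tot_cupl.
by move: h1; rewrite -compA tot_idl tot_comp tot_tens tot_cupr.
Qed.

Lemma dual_ev X Y (f : mor X Y) :
  (pev X ∘ (dual_mor f ⊠ X) = pev Y ∘ (Y^* ⊠ f))%arr.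
Proof.
have -> : tot (dual_mor f) =
    (((pev Y ∘ (Y^* ⊠ f)) ⊠ X^*) ∘ (Y^* ⊠ pcoev X))%arr.
  rewrite /dual_mor /dual_morL -2!compA tot_idl 2!tot_comp tot_cupr.
  by rewrite acompA whiskerr.
rewrite -{1}[tot (pev X)]aten1; apply: unbendl => //; exact: adjointL.
Qed.

(** [dual_mor] is built from the left duality, but it coincides with the dual
    built from the right duality, to which this rule belongs. *)
Lemma dual_evt X Y (f : mor X Y) :
  (pevt X ∘ (X ⊠ dual_mor f) = pevt Y ∘ (f ⊠ Y^*))%arr.
Proof.
have -> : tot (dual_mor f) =
    ((X^* ⊠ (pevt Y ∘ (f ⊠ Y^*))) ∘ (pcoevt X ⊠ Y^*))%arr.
  have [eqLR _ _] := pivLR C.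
  rewrite /dual_mor eqLR /dual_morR -2!compA tot_idl 2!tot_comp tot_cupl.
  by rewrite acompA whiskerl.
rewrite -{1}[tot (pevt X)]atenr1; apply: unbendr => //; exact: adjointR.
Qed.

Lemma dual_coevt X Y (f : mor X Y) :
  ((X^* ⊠ f) ∘ pcoevt X = (dual_mor f ⊠ Y) ∘ pcoevt Y)%arr.
Proof.
by apply: conj_cups (adjointR Y) (adjointR X) _; rewrite dual_evt.
Qed.

Lemma tot_ptrl X Y Z (f : mor (X ⊗ Y) (X ⊗ Z)) :
  tot (ptrl f) = ((pev X ⊠ Z) ∘ (X^* ⊠ f) ∘ (pcoevt X ⊠ Y))%arr.
Proof. by rewrite /ptrl 2!tot_comp tot_cupl tot_capl. Qed.

Lemma tot_ptrr X Y Z (f : mor (Y ⊗ X) (Z ⊗ X)) :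
  tot (ptrr f) = ((Z ⊠ pevt X) ∘ (f ⊠ X^*) ∘ (Y ⊠ pcoev X))%arr.
Proof. by rewrite /ptrr 2!tot_comp tot_cupr tot_capr. Qed.

(** The morphism [h] travels around the closed loop: through the cap as its left
    dual, back through the cup as its right dual. *)
Lemma ptrl_cyclic X X' Y Z (h : mor X' X) (f : mor (X ⊗ Y) (X' ⊗ Z)) :
  ptrl ((h ⊠ idm Z) ∘ f) = ptrl (f ∘ (h ⊠ idm Y)).
Proof.
apply: tot_inj; rewrite !tot_ptrl !tot_comp !tot_tens !whiskerl //.
rewrite acompA -!atenA -whiskerr // -dual_ev whiskerr // -!acompA.
congr (_ ∘ _)%arr.
rewrite -[in RHS]whiskerr // dual_coevt whiskerr // !acompA.
by rewrite !atenA -!ida_tens slidel // slider.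
Qed.

Lemma ptrl_nat X Y Z Y' Z' (a : mor Y' Y) (f : mor (X ⊗ Y) (X ⊗ Z))
    (b : mor Z Z') :
  ptrl ((idm X ⊠ b) ∘ f ∘ (idm X ⊠ a)) = b ∘ ptrl f ∘ a.
Proof.
apply: tot_inj; rewrite (tot_comp _ a) (tot_comp b) !tot_ptrl !tot_comp.
rewrite !tot_tens !whiskerl //.
rewrite -/(ida X) -!atenA -!acompA (aten_cupl (f := pcoevt X) (g := a)) // !acompA.
rewrite (aten_capl (f := pev X) (g := b)) // -!ida_tens.
rewrite (slider (f := pev X) (g := b)) // -!acompA.
by rewrite (slidel (f := pcoevt X) (g := a)).
Qed.

(** Loops closed on the two sides of a diagram do not interact. *)
Lemma ptrl_ptrr A B X Z (f : mor (A ⊗ X ⊗ B) (A ⊗ Z ⊗ B)) :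
  ptrl (ptrr f) = ptrr (ptrl (assoc A Z B ∘ f ∘ assocV A X B)).
Proof.
apply: tot_inj; rewrite tot_ptrl !tot_ptrr tot_ptrl tot_idr tot_idl.
rewrite !whiskerl ?whiskerr //; try objs.
transitivity ((pev A ⊠ (Z ⊠ pevt B)) ∘ (A^* ⊠ f ⊠ B^*)
               ∘ (pcoevt A ⊠ (X ⊠ pcoev B)))%arr.
  rewrite !acompA -(acompA _ _ (pcoevt A ⊠ X)%arr); congr (_ ∘ _ ∘ _)%arr.
  - by rewrite ida_tens !atenA -(atenA A^*) -(ida_tens A^* A) slider //; objs.
  - by rewrite -!atenA.
  - by rewrite ida_tens !atenA -(atenA A^*) -(ida_tens A^* A) slidel //; objs.
rewrite !acompA -(acompA _ _ (X ⊠ pcoev B)%arr); congr (_ ∘ _ ∘ _)%arr.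
  by rewrite ida_tens !atenA -!ida_tens aten_capl //; objs.
by rewrite ida_tens !atenA -!ida_tens aten_cupl //; objs.
Qed.

Definition coev2 X Y : mor unit1 ((X ⊗ Y) ⊗ (Y^* ⊗ X^*)) :=
  assocV X Y (Y^* ⊗ X^*) ∘ (idm X ⊠ cupl (pcoev Y) X^*) ∘ pcoev X.

Definition coevt2 X Y : mor unit1 ((Y^* ⊗ X^*) ⊗ (X ⊗ Y)) :=
  assocV Y^* X^* (X ⊗ Y) ∘ (idm Y^* ⊠ cupl (pcoevt X) Y) ∘ pcoevt Y.

Lemma tot_ev2 X Y :
  tot (ev2 (piv_dual C) X Y) = (pev Y ∘ (Y^* ⊠ pev X ⊠ Y))%arr.
Proof. by rewrite /ev2 tot_idr tot_comp tot_tens tot_capl atenA. Qed.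

Lemma tot_evt2 X Y :
  tot (evt2 (piv_dual C) X Y) = (pevt X ∘ (X ⊠ pevt Y ⊠ X^*))%arr.
Proof. by rewrite /evt2 tot_idr tot_comp tot_tens tot_capl atenA. Qed.

Lemma tot_coev2 X Y : tot (coev2 X Y) = ((X ⊠ pcoev Y ⊠ X^*) ∘ pcoev X)%arr.
Proof. by rewrite /coev2 -compA tot_idl tot_comp tot_tens tot_cupl atenA. Qed.

Lemma tot_coevt2 X Y : tot (coevt2 X Y) = ((Y^* ⊠ pcoevt X ⊠ Y) ∘ pcoevt Y)%arr.
Proof. by rewrite /coevt2 -compA tot_idl tot_comp tot_tens tot_cupl atenA. Qed.

Lemma adjoint2L X Y : adjoint (ev2 (piv_dual C) X Y) (coev2 X Y).
Proof.
exact: adjoint_comp (adjointL X) (adjointL Y) (tot_ev2 X Y) (tot_coev2 X Y).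
Qed.

Lemma adjoint2R X Y : adjoint (evt2 (piv_dual C) X Y) (coevt2 X Y).
Proof.
exact: adjoint_comp (adjointR Y) (adjointR X) (tot_evt2 X Y) (tot_coevt2 X Y).
Qed.

Definition dual_mult X Y : mor (Y^* ⊗ X^*) (X ⊗ Y)^* :=
  dual_multL (piv_dual C) X Y.

Lemma dual_mult_ev X Y :
  (pev (X ⊗ Y) ∘ (dual_mult X Y ⊠ (X ⊗ Y)) = ev2 (piv_dual C) X Y)%arr.
Proof. exact: mate_cap (adjointL _). Qed.

Lemma dual_mult_evt X Y :
  (pevt (X ⊗ Y) ∘ ((X ⊗ Y) ⊠ dual_mult X Y) = evt2 (piv_dual C) X Y)%arr.
Proof.
have [_ eqLR _] := pivLR C.
rewrite /dual_mult eqLR /dual_multR -compA tot_idl tot_comp tot_cupl tot_tens.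
rewrite -{1}[tot (pevt _)]atenr1; apply: unbendr => //; exact: adjointR.
Qed.

(** By definition [dual_mult] compares the nested cap with the cap of [X ⊗ Y] for
    the left duality.  Because the right duality gives the same comparison, it
    also relates the cups of the right duality. *)
Lemma dual_mult_coevt X Y :
  ((dual_mult X Y ⊠ (X ⊗ Y)) ∘ coevt2 X Y = pcoevt (X ⊗ Y))%arr.
Proof.
rewrite -(conj_cups (k := idm (X ⊗ Y)) (adjoint2R X Y) (adjointR (X ⊗ Y))).
  by rewrite -/(ida _) -ida_tens acomp1.
by rewrite dual_mult_evt -/(ida _) -ida_tens acompr1.
Qed.

(** The loop of [A ⊗ X] is the loop of [A] nested in the loop of [X]: the
    comparison morphism [dual_mult] between the two duals of [A ⊗ X] is created
    at the cup and absorbed by the cap. *)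
Lemma ptrl_tens A X Y Z (f : mor (A ⊗ X ⊗ Y) (A ⊗ X ⊗ Z)) :
  ptrl f = ptrl (ptrl (assoc A X Z ∘ f ∘ assocV A X Y)).
Proof.
apply: tot_inj; rewrite !tot_ptrl tot_idr tot_idl.
rewrite -dual_mult_coevt whiskerr // acompA.
rewrite -(acompA _ _ (dual_mult A X ⊠ _ ⊠ _)%arr) atenA -ida_tens slidel //.
rewrite -(slider (X := X^* ⊗ A^*) (Y := (A ⊗ X) ⊗ Z) (f := dual_mult A X)) //.
rewrite (ida_tens (A ⊗ X) Z) -atenA acompA -whiskerr // dual_mult_ev.
rewrite tot_ev2 tot_coevt2 !whiskerr; try by objs.
by rewrite !whiskerl ?acompA ?ida_tens ?atenA //; objs.
Qed.

Lemma tot_phi Y : tot (phi Y) = ((pevt Y ⊠ Y^*^*) ∘ (Y ⊠ pcoev Y^*))%arr.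
Proof. by rewrite /phi -compA tot_idl tot_comp tot_cupr. Qed.

Lemma phi_ev Y : (pev Y^* ∘ (phi Y ⊠ Y^*) = pevt Y)%arr.
Proof. exact: mate_cap (adjointL _). Qed.

(** Both sides are bent into the cap [pev Y]: on the left [pev Y] is slid through
    the cap of the unit, on the right a zigzag for [Y^*] is pulled straight.  The
    point of this equation is that the same bending on the other side, done with
    the right duality, turns it into [phi_evt]. *)
Lemma dual_pev Y :
  dual_mor (pev Y) ∘ dual_unitL (piv_dual C) = dual_mult Y^* Y ∘ pcoev Y^*.
Proof.
apply: (cap_inj (adjointL _)).
rewrite (tot_comp (dual_mor _)) (tot_comp (dual_mult _ _)) !whiskerr //.
rewrite !acompA dual_ev dual_mult_ev tot_ev2 tot_idl -!acompA.
rewrite -/(pcoev unit1) (slidel (f := pcoev unit1)) //; last by objs.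
have [] := adjointL (unit1 : C); rewrite aten1 atenr1 => zag1 _.
have [zag _] := adjointL Y^*.
rewrite aten_through // acompA zag1 acomp1 //.
by rewrite ida_tens -atenA -whiskerr ?zag -?ida_tens ?acompr1 //; objs.
Qed.

(** The companion of [phi_ev] for the right duality of [Y^*].  It says that the two
    canonical morphisms from [Y] to [Y^*^*], one of which is [phi Y], agree.  The
    zigzag identities do not suffice for this; it comes from the equality of the
    two dual functors on [pev Y], together with the equality of their unit and
    product constraints. *)
Lemma phi_evt Y : (pevt Y^* ∘ (Y^* ⊠ phi Y) = pev Y)%arr.
Proof.
have [_ _ eqU] := pivLR C.
have := congr1 (fun x => (pevt (Y^* ⊗ Y) ∘ ((Y^* ⊗ Y) ⊠ tot x))%arr) (dual_pev Y).
rewrite eqU (tot_comp (dual_mor _)) (tot_comp (dual_mult _ _)) !whiskerl //.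
rewrite !acompA dual_evt dual_mult_evt tot_evt2 tot_idl -!acompA.
rewrite -/(pcoevt unit1) (slider (g := pcoevt unit1)) //; last by objs.
have [_] := adjointR (unit1 : C); rewrite aten1 atenr1 => zag1.
rewrite aten_through_rev // acompA zag1 acomp1 // => ->.
by rewrite ida_tens !atenA -whiskerl -?tot_phi //; objs.
Qed.

Lemma phi_coev Y : ((phi Y ⊠ Y^*) ∘ pcoev Y = pcoevt Y^*)%arr.
Proof.
rewrite -(conj_cups (k := idm Y^*) (adjointL Y) (adjointR Y^*)).
  by rewrite -/(ida _) -ida_tens acomp1.
by rewrite phi_evt -/(ida _) -ida_tens acompr1.
Qed.

(** A left loop of [X^*] is a loop of [X] run in the other direction: [phi X] is
    created at the cup and absorbed by the cap. *)
Lemma tot_ptrl_dual X Y Z (f : mor (X^* ⊗ Y) (X^* ⊗ Z)) :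
  tot (ptrl f) = ((pevt X ⊠ Z) ∘ (X ⊠ f) ∘ (pcoev X ⊠ Y))%arr.
Proof.
rewrite tot_ptrl -phi_coev whiskerr // acompA -(acompA _ _ (phi X ⊠ _ ⊠ _)%arr).
rewrite atenA -ida_tens slidel // -(slider (f := phi X) (X := X) (Y := X^* ⊗ Z)) //.
by rewrite acompA ida_tens -atenA -whiskerr // phi_ev.
Qed.

(** If [F] is the dual of [f], up to the identification of [(X ⊗ Y)^*] with
    [Y^* ⊗ X^*], then closing the strand [Y^*] of [F] on the left is dual to
    closing the strand [Y] of [f] on the right.  This is what makes the dual of a
    left trace a right trace. *)
Lemma ptrl_dual X Y (f : mor (X ⊗ Y) (X ⊗ Y))
    (F : mor (Y^* ⊗ X^*) (Y^* ⊗ X^*)) :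
  (ev2 (piv_dual C) X Y ∘ (F ⊠ (X ⊗ Y)) =
   ev2 (piv_dual C) X Y ∘ ((Y^* ⊗ X^*) ⊠ f))%arr ->
  ptrl F = dual_mor (ptrr f).
Proof.
move=> eqF; apply: (cap_inj (adjointL X)).
rewrite dual_ev tot_ptrl_dual tot_ptrr.
(* [K] is the part of the diagram in which [f] acts before [Y] is closed. *)
pose K := ((pev X ⊠ (Y ⊗ Y^*)) ∘ (X^* ⊠ ((f ⊠ Y^*) ∘ (X ⊠ pcoev Y))))%arr.
have [zag zig] := adjointL Y.
transitivity (pevt Y ∘ K)%arr; last first.
  rewrite /K -[in RHS]acompA [in RHS]whiskerl; last by objs.
  rewrite !acompA; congr (_ ∘ _)%arr.
  by rewrite -atenA -ida_tens aten_capr // aten_capl.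
(* A zigzag on [Y^*] next to [pev X] makes the nested cap [ev2] appear, through
   which [F] can be turned into [f]. *)
have unzig : (Y^* ⊠ pev X =
    (ev2 (piv_dual C) X Y ⊠ Y^*) ∘ (((Y^* ⊗ X^*) ⊗ X) ⊠ pcoev Y))%arr.
  rewrite tot_ev2 whiskerr; last by objs.
  rewrite -acompA (atenA _ Y Y^*) -(ida_tens Y) slider; try by objs.
  rewrite atenA (aten_through_rev (f := pev X)) // whiskerl // acompA zig.
  by rewrite acomp1 //; objs.
have slide : ((Y^* ⊠ pev X) ∘ (F ⊠ X) = (pev Y ⊠ Y^*) ∘ (Y^* ⊠ K))%arr.
  rewrite unzig -acompA aten_cupr //.
  rewrite -(slider (f := (F ⊠ X)%arr) (X := Y^* ⊗ X^* ⊗ X) (Y := Y ⊗ Y^*)) //.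
  rewrite acompA ida_tens -atenA (atenA F) -ida_tens -whiskerr // eqF.
  rewrite whiskerr // tot_ev2 whiskerr; last by objs.
  rewrite -!acompA; congr (_ ∘ _)%arr.
  rewrite /K !whiskerl; try by objs.
  by rewrite !ida_tens !atenA.
transitivity (pevt Y ∘ (Y ⊠ ((Y^* ⊠ pev X) ∘ (F ⊠ X)))
              ∘ (pcoev Y ⊠ (X^* ⊗ X)))%arr.
  rewrite 2?whiskerr //; try by objs.
  rewrite !acompA atenA -ida_tens (aten_capl (f := pevt Y)) //.
  rewrite -(aten_capr (X := Y ⊗ Y^*) (f := pevt Y) (g := pev X)) //.
  rewrite whiskerl; last by objs.
  by rewrite acompA !ida_tens !atenA.
rewrite slide whiskerl; last by objs.
rewrite -!acompA; congr (_ ∘ _)%arr.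
rewrite -[in LHS](atenA Y Y^*) -[in LHS](ida_tens Y Y^*).
rewrite (slidel (f := pcoev Y)) //; last by objs.
rewrite -(aten_cupl (f := pcoev Y) (g := K) (X := Y ⊗ Y^*)); try by objs.
rewrite acompA ida_tens -!atenA -whiskerr; last by objs.
by rewrite zag -ida_tens acomp1 //; objs.
Qed.

End PivotalCalculus.

(** * The mirror image of a pivotal category *)

Section Mirror.
Variable C : strict_monoidal.

(** Reversing the tensor product exchanges the two dualities, hence left and right
    partial traces; each one-sided statement yields its mirror image. *)
Definition mirror_smc : strict_monoidal :=
  @StrictMonoidal C (fun X Y => Y ⊗ X) unit1 (fun X X' Y Y' f g => g ⊠ f)
    (fun X Y => tensm_id Y X)
    (fun X X' X'' Y Y' Y'' f' f g' g => tensm_comp g' g f' f)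
    (fun X Y Z => esym (tensA Z Y X)) (fun X => tensX1 X) (fun X => tens1X X)
    (fun X X' Y Y' Z Z' f g h => assocV_nat h g f)
    (fun X X' f => tensm1 f) (fun X X' f => tens1m f).

Variable D : duality_data C.

Definition mirror_dual : duality_data mirror_smc :=
  @DualityData mirror_smc (dual D) (evt D) (coevt D) (ev D) (coev D).

Lemma assocV_mirror (X Y Z : C) : @assocV mirror_smc X Y Z = @assoc C Z Y X.
Proof. exact: idto_irr. Qed.

Lemma cupr_mirror (A B : C) (c : mor unit1 (A ⊗ B)) (Z : C) :
  @cupr mirror_smc B A c Z = @cupl C A B c Z.
Proof. by rewrite /cupr assocV_mirror. Qed.

Lemma capl_mirror (A B : C) (e : mor (A ⊗ B) unit1) (Z : C) :
  @capl mirror_smc B A e Z = @capr C A B e Z.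
Proof. by rewrite /capl assocV_mirror. Qed.

Lemma left_duality_mirror : right_duality D -> left_duality mirror_dual.
Proof.
move=> dR X; have [h1 h2] := dR X; split; last by rewrite cupr_mirror.
exact: h1.
Qed.

Lemma right_duality_mirror : left_duality D -> right_duality mirror_dual.
Proof.
move=> dL X; have [h1 h2] := dL X; split; first by rewrite cupr_mirror.
exact: h2.
Qed.

Lemma dual_morL_mirror (X Y : C) (f : mor X Y) :
  @dual_morL mirror_smc mirror_dual X Y f = dual_morR D f.
Proof. by rewrite /dual_morL cupr_mirror. Qed.

Lemma ev2_mirror (X Y : C) : evt2 D Y X = @ev2 mirror_smc mirror_dual X Y.
Proof.
transitivity (evt D Y ∘ (capr (evt D X) Y ⊠ idm (dual D Y))
              ∘ assocV (Y ⊗ X) (dual D X) (dual D Y)).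
  apply: tot_inj; rewrite /evt2 !tot_idr !tot_comp !tot_tens tot_capr tot_capl.
  by rewrite atenA.
by rewrite [in RHS]/ev2 capl_mirror.
Qed.

Lemma evt2_mirror (X Y : C) : ev2 D Y X = @evt2 mirror_smc mirror_dual X Y.
Proof.
transitivity (ev D X ∘ (capr (ev D Y) (dual D X) ⊠ idm X)
              ∘ assocV (dual D X ⊗ dual D Y) Y X).
  apply: tot_inj; rewrite /ev2 !tot_idr !tot_comp !tot_tens tot_capr tot_capl.
  by rewrite atenA.
by rewrite [in RHS]/evt2 capl_mirror.
Qed.

Lemma same_dual_mirror : same_dual_functors D -> same_dual_functors mirror_dual.
Proof.
move=> [eqf eqm equ]; split.
- by move=> X Y f; rewrite dual_morL_mirror; apply/esym/eqf.
- move=> X Y; rewrite /dual_multL -ev2_mirror cupr_mirror /dual_multR -evt2_mirror.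
  exact/esym/eqm.
- exact/esym/equ.
Qed.

End Mirror.

Definition mirror (C : pivotal_category) : pivotal_category :=
  PivotalCategory (left_duality_mirror (@pivR C))
    (right_duality_mirror (@pivL C)) (same_dual_mirror (@pivLR C)).

Section RightTraces.
Variable C : pivotal_category.
Implicit Types X Y Z A B : C.

Lemma ptrl_mirror X Y Z (f : mor (Y ⊗ X) (Z ⊗ X)) :
  @ptrl (mirror C) X Y Z f = ptrr f.
Proof. by rewrite /ptrl capl_mirror. Qed.

Lemma ptrr_cyclic X X' Y Z (h : mor X' X) (f : mor (Y ⊗ X) (Z ⊗ X')) :
  ptrr ((idm Z ⊠ h) ∘ f) = ptrr (f ∘ (idm Y ⊠ h)).
Proof.
by have := @ptrl_cyclic (mirror C) X X' Y Z h f; rewrite !ptrl_mirror.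
Qed.

Lemma ptrr_nat X Y Z Y' Z' (a : mor Y' Y) (f : mor (Y ⊗ X) (Z ⊗ X))
    (b : mor Z Z') :
  ptrr ((b ⊠ idm X) ∘ f ∘ (a ⊠ idm X)) = b ∘ ptrr f ∘ a.
Proof.
by have := @ptrl_nat (mirror C) X Y Z Y' Z' a f b; rewrite !ptrl_mirror.
Qed.

Lemma ptrr_tens A X Y Z (f : mor (Y ⊗ (X ⊗ A)) (Z ⊗ (X ⊗ A))) :
  ptrr f = ptrr (ptrr (assocV Z X A ∘ f ∘ assoc Y X A)).
Proof.
have := @ptrl_tens (mirror C) A X Y Z f; rewrite !ptrl_mirror => ->.
by rewrite assocV_mirror.
Qed.

End RightTraces.

(** * Projective objects and dual morphisms *)

Section Projective.
Variable C : pivotal_category.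
Implicit Types X Y Z A B P V : C.

Lemma retract_projective X Y : retract X Y -> projective Y -> projective X.
Proof.
move=> [p [q pq]] projY A B e f epi_e.
have [g eq_g] := projY A B e (f ∘ p) epi_e.
by exists (g ∘ q); rewrite compA -eq_g -compA pq compm1.
Qed.

Lemma epi_retract X Y (p : mor X Y) : epi p -> projective Y -> retract Y X.
Proof.
by move=> epi_p projY; have [q eq_q] := projY _ _ p (idm Y) epi_p; exists p, q.
Qed.

Lemma epi_comp X Y Z (p : mor Y Z) (h : mor X Y) : epi (p ∘ h) -> epi p.
Proof. by move=> epi_ph W a b eq_ab; apply: epi_ph; rewrite !compA eq_ab. Qed.

Lemma epi_idtol X Y Z (p : mor X Y) (e : Y = Z) : epi p -> epi (idto e ∘ p).
Proof. by subst Z; rewrite comp1m. Qed.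

Lemma epi_idtor X Y Z (p : mor Y Z) (e : X = Y) : epi p -> epi (p ∘ idto e).
Proof. by subst Y; rewrite compm1. Qed.

(** The functor [X ⊗ -] is left adjoint to [X^* ⊗ -]. *)
Definition curryl X Y Z (f : mor (X ⊗ Y) Z) : mor Y (X^* ⊗ Z) :=
  (idm X^* ⊠ f) ∘ cupl (pcoevt X) Y.

Definition uncurryl X Y Z (g : mor Y (X^* ⊗ Z)) : mor (X ⊗ Y) Z :=
  capl (pevt X) Z ∘ (idm X ⊠ g).

Lemma currylK X Y Z (f : mor (X ⊗ Y) Z) : uncurryl (curryl f) = f.
Proof.
apply: tot_inj; rewrite tot_comp tot_capl tot_tens (tot_comp (idm _ ⊠ f)).
by rewrite tot_tens tot_cupl; apply: unbendr (adjointR X) _ _.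
Qed.

Lemma curryl_nat X Y Y' Z (f : mor (X ⊗ Y) Z) (a : mor Y' Y) :
  curryl (f ∘ (idm X ⊠ a)) = curryl f ∘ a.
Proof.
apply: tot_inj; rewrite (tot_comp (curryl f)) !(tot_comp (idm _ ⊠ _)) !tot_tens.
rewrite !tot_cupl tot_comp whiskerl // -!acompA; congr (_ ∘ _)%arr.
rewrite tot_tens -atenA -ida_tens slidel //.
by rewrite aten_cupl.
Qed.

Lemma uncurryl_nat X Y Z Z' (g : mor Y (X^* ⊗ Z)) (b : mor Z Z') :
  uncurryl ((idm X^* ⊠ b) ∘ g) = b ∘ uncurryl g.
Proof.
apply: tot_inj; rewrite (tot_comp b) !(tot_comp (capl _ _)) !tot_tens.
rewrite !tot_capl tot_comp whiskerl // !acompA; congr (_ ∘ _)%arr.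
rewrite tot_tens -atenA -ida_tens slider //.
by rewrite aten_capl.
Qed.

(** Left adjoints preserve epimorphisms. *)
Lemma epi_tensl X Y Z (p : mor Y Z) : epi p -> epi (idm X ⊠ p).
Proof.
move=> epi_p W a b eq_ab; rewrite -(currylK a) -(currylK b); congr uncurryl.
by apply: epi_p; rewrite -!curryl_nat eq_ab.
Qed.

(** A left adjoint preserves projectivity when its right adjoint, here [X^* ⊗ -],
    preserves epimorphisms. *)
Lemma projective_tensl X P : projective P -> projective (X ⊗ P).
Proof.
move=> projP A B p f epi_p.
have [g eq_g] := projP _ _ _ (curryl f) (@epi_tensl X^* _ _ p epi_p).
by exists (uncurryl g); rewrite -uncurryl_nat -eq_g currylK.
Qed.

End Projective.

Section ProjectiveDual.
Variable C : pivotal_category.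
Implicit Types X Y Z A B P V : C.

Lemma epi_tensr X Y Z (p : mor Y Z) : epi p -> epi (p ⊠ idm X).
Proof. exact: (@epi_tensl (mirror C) X Y Z p). Qed.

Lemma projective_tensr X P : projective P -> projective (P ⊗ X).
Proof. exact: (@projective_tensl (mirror C) X P). Qed.

(** A zigzag exhibits [P^*] as a retract of [P^* ⊗ P ⊗ P^*]. *)
Lemma projective_dual P : projective P -> projective P^*.
Proof.
move=> projP; apply: (@retract_projective _ _ (P^* ⊗ P ⊗ P^*)).
  exists (lunit P^* ∘ (pev P ⊠ idm P^*)), (cupr (pcoev P) P^*).
  exact: (proj2 (pivL P)).
by apply/projective_tensr/projective_tensl.
Qed.

(** [X ⊗ pev P] is again an epimorphism, and it splits when [X] is projective. *)
Lemma projective_retractl P X : epi (pev P) -> projective X ->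
  retract X (X ⊗ P^* ⊗ P).
Proof.
move=> epi_ev; apply: (epi_retract (p := capr (pev P) X)).
exact/epi_idtor/epi_idtol/epi_tensl.
Qed.

Lemma projective_retractr P X : epi (pev P) -> projective X ->
  retract X (P^* ⊗ (P ⊗ X)).
Proof.
move=> epi_ev; apply: (epi_retract (p := capl (pev P) X)).
exact/epi_idtor/epi_idtol/epi_tensr.
Qed.

Lemma epi_pev_dual X : epi (pevt X) -> epi (pev X^*).
Proof.
rewrite (_ : pevt X = pev X^* ∘ (phi X ⊠ idm X^*)); first exact: epi_comp.
by apply: tot_inj; rewrite tot_comp tot_tens phi_ev.
Qed.

Lemma epi_pevt_dual X : epi (pev X) -> epi (pevt X^*).
Proof.
rewrite (_ : pev X = pevt X^* ∘ (idm X^* ⊠ phi X)); first exact: epi_comp.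
by apply: tot_inj; rewrite tot_comp tot_tens phi_evt.
Qed.

Lemma dual_mor_comp X Y Z (g : mor Y Z) (f : mor X Y) :
  dual_mor (g ∘ f) = dual_mor f ∘ dual_mor g.
Proof.
apply: (cap_inj (adjointL X)); rewrite dual_ev (tot_comp (dual_mor f)) tot_comp.
rewrite whiskerl // whiskerr // !acompA dual_ev -dual_ev -!acompA.
by rewrite slidel // slider.
Qed.

Lemma dual_mor_id X : dual_mor (idm X) = idm X^*.
Proof. by apply: (cap_inj (adjointL X)); rewrite dual_ev. Qed.

Lemma dual_mor_surj X Y (g : mor Y^* X^*) : exists f : mor X Y, dual_mor f = g.
Proof.
exists (runit Y ∘ (idm Y ⊠ (pev X ∘ (g ⊠ idm X))) ∘ cupl (pcoev Y) X).
apply: (cap_inj (adjointL X)); rewrite dual_ev -compA tot_idl tot_comp.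
rewrite tot_cupl tot_tens tot_comp -[X in (X ∘ _)%arr]atenr1.
by rewrite (unbendr (adjointL Y)).
Qed.

(** The identifications [a] and [b] of [Y^* ⊗ X^*] with [(X ⊗ Y)^*] turn the dual
    of [f] into an endomorphism whose strand [Y^*] can be closed. *)
Lemma dual_endo_tens X Y (f : mor (X ⊗ Y) (X ⊗ Y)) :
  exists (a : mor (Y^* ⊗ X^*) (X ⊗ Y)^*) (b : mor (X ⊗ Y)^* (Y^* ⊗ X^*)),
    a ∘ b = idm _ /\ ptrl (b ∘ dual_mor f ∘ a) = dual_mor (ptrr f).
Proof.
pose b := mate (pev (X ⊗ Y)) (coev2 X Y).
have eq_b : (ev2 (piv_dual C) X Y ∘ (b ⊠ (X ⊗ Y)) = pev (X ⊗ Y))%arr.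
  exact: mate_cap (adjoint2L X Y).
exists (dual_mult X Y), b; split.
  apply: (cap_inj (adjointL _)); rewrite tot_comp whiskerr // acompA.
  by rewrite dual_mult_ev eq_b -/(ida _) -ida_tens acompr1.
apply: ptrl_dual; rewrite (tot_comp _ (dual_mult X Y)) (tot_comp b) 2?whiskerr //.
rewrite !acompA eq_b dual_ev -acompA slidel // -dual_mult_ev -acompA.
by rewrite slider.
Qed.

End ProjectiveDual.

(** * Traces on projective objects and the slope *)

Lemma linear_scal (k : fieldType) (M N : lmodType k) (F : M -> N)
    (a : k) (u : M) :
  linear F -> F (a *: u) = a *: F u.
Proof.
move=> linF; have F0 : F 0 = 0.
  by have := linF (-1) 0 0; rewrite scaler0 addr0 scaleN1r addNr.
by have := linF a u 0; rewrite F0 !addr0.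
Qed.

Section Linear.
Variables (k : fieldType) (C : pivotal_kcategory k).
Implicit Types P U V W X Y Z : C.

Lemma compZl X Y Z (a : k) (g : mor Y Z) (f : mor X Y) :
  (a *: g) ∘ f = a *: (g ∘ f).
Proof. exact: linear_scal (comp_linl f). Qed.

Lemma compZr X Y Z (a : k) (g : mor Y Z) (f : mor X Y) :
  g ∘ (a *: f) = a *: (g ∘ f).
Proof. exact: linear_scal (comp_linr g). Qed.

Lemma tensZl X X' Y Y' (a : k) (f : mor X X') (g : mor Y Y') :
  (a *: f) ⊠ g = a *: (f ⊠ g).
Proof. exact: linear_scal (tensm_linl g). Qed.

Lemma tensZr X X' Y Y' (a : k) (f : mor X X') (g : mor Y Y') :
  f ⊠ (a *: g) = a *: (f ⊠ g).
Proof. exact: linear_scal (tensm_linr f). Qed.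

Lemma dual_morZ X Y (a : k) (f : mor X Y) : dual_mor (a *: f) = a *: dual_mor f.
Proof. by rewrite /dual_mor /dual_morL tensZr tensZl compZr compZl. Qed.

(** A generator of the module of endomorphisms is a nonzero multiple of the
    identity, since the identity is itself a multiple of it. *)
Lemma simpleP X : simple X <->
  (forall f : mor X X, exists a : k, f = a *: idm X) /\ idm X != 0.
Proof.
split=> [[e gen_e]|[scal id_neq0]].
  have [c [id_c _]] := gen_e (idm X).
  have c_neq0 : c != 0.
    apply/eqP=> c0; have e0 : e = 0.
      by rewrite -[LHS]compm1 id_c c0 compZr scale0r.
    have [a [_ uniq_a]] := gen_e 0.
    have a1 : a = 1 by apply: uniq_a; rewrite e0 scaler0.
    have a0 : a = 0 by apply: uniq_a; rewrite e0 scaler0.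
    by have := oner_neq0 k; rewrite -a1 a0 eqxx.
  have e_id : e = c^-1 *: idm X by rewrite id_c scalerA mulVf // scale1r.
  split=> [f|].
    have [a [-> _]] := gen_e f; exists (a / c).
    by rewrite -scalerA -e_id.
  apply/eqP=> id0; have [a [_ uniq_a]] := gen_e (idm X).
  have a1 : a = 1 by apply: uniq_a; rewrite e_id id0 !scaler0.
  have a0 : a = 0 by apply: uniq_a; rewrite e_id id0 !scaler0.
  by have := oner_neq0 k; rewrite -a1 a0 eqxx.
exists (idm X) => f; have [a ->] := scal f; exists a; split=> // b /eqP.
by rewrite -subr_eq0 -scalerBl scaler_eq0 (negPf id_neq0) orbF subr_eq0 => /eqP.
Qed.

Lemma simple_dual X : simple X -> simple X^*.
Proof.
move=> /simpleP [scal id_neq0]; apply/simpleP; split=> [g|].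
  have [f <-] := dual_mor_surj g; have [a ->] := scal f.
  by exists a; rewrite dual_morZ dual_mor_id.
(* If [idm X^*] vanished, so would [pev X], and with it the zigzag on [X]. *)
apply: contra_neq id_neq0 => id0.
have ev0 : pev X = 0 *: pev X.
  rewrite -{1}[pev X]compm1 -tensm_id id0 -(scale0r (0 : mor X^* X^*)).
  by rewrite tensZl compZr !scale0r.
rewrite -(proj1 (pivL X)) -/(pev X) ev0 tensZr compZr compZl.
by rewrite scale0r.
Qed.

End Linear.

Section Traces.
Variables (k : fieldType) (C : pivotal_kcategory k).
Implicit Types P U V W X Y Z : C.
Variable tr : forall X : C, {scalar mor X X}.
Hypothesis tr_left : left_trace tr.

Lemma tr_cyclic U V (g : mor U V) (h : mor V U) :
  projective U -> projective V -> tr V (g ∘ h) = tr U (h ∘ g).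
Proof. by case: tr_left => cyc _ pU pV; apply: cyc. Qed.

Lemma tr_tens X Y (f : mor (Y ⊗ X) (Y ⊗ X)) :
  projective X -> tr (Y ⊗ X) f = tr X (ptrl f).
Proof. by case: tr_left => _ ptr pX; apply: ptr. Qed.

Lemma dual_trace_cyclic U V (g : mor U V) (h : mor V U) :
  projective U -> projective V ->
  dual_trace tr (g ∘ h) = dual_trace tr (h ∘ g).
Proof.
move=> pU pV; rewrite /dual_trace !dual_mor_comp tr_cyclic //.
all: exact: projective_dual.
Qed.

(** Cyclicity transports the dual of [f] to [Y^* ⊗ X^*], where the left trace
    property closes [Y^*]; by [ptrl_dual] this is closing [Y] on the right. *)
Lemma dual_trace_tens X Y (f : mor (X ⊗ Y) (X ⊗ Y)) :
  projective X -> dual_trace tr f = dual_trace tr (ptrr f).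
Proof.
move=> pX; have [a [b [ab1 eq_ptr]]] := dual_endo_tens f.
rewrite /dual_trace -eq_ptr -tr_tens; last exact: projective_dual.
rewrite -compA -tr_cyclic ?comp1m; last first.
- exact/projective_dual/projective_tensr.
- exact/projective_tensl/projective_dual.
by rewrite -compA ab1 compm1.
Qed.

(** The left ambidexterity condition with [P] and [P^*] replaced by any [X] and
    [Y]: [exchange P P^*] is that condition once [phi P] is cancelled by
    cyclicity.  It allows a strand to be closed on either side. *)
Definition exchange X Y := forall f : mor (X ⊗ Y) (X ⊗ Y),
  tr X (ptrr f) = dual_trace tr (ptrl f).

Lemma exchange_retractl X Y Z : projective X -> projective Z ->
  retract Z X -> exchange X Y -> exchange Z Y.
Proof.
move=> pX pZ [p [q pq]] exXY f.
have := exXY ((q ⊠ idm Y) ∘ f ∘ (p ⊠ idm Y)).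
rewrite ptrr_nat -compA tr_cyclic // -[X in tr Z X]compA pq compm1 => ->.
by rewrite -compA ptrl_cyclic -compA -tensm_compl pq tensm_id compm1.
Qed.

Lemma exchange_retractr X Y Z : projective Y -> projective Z ->
  retract Z Y -> exchange X Y -> exchange X Z.
Proof.
move=> pY pZ [p [q pq]] exXY f.
have := exXY ((idm X ⊠ q) ∘ f ∘ (idm X ⊠ p)).
rewrite ptrl_nat -[X in ptrr X]compA ptrr_cyclic -[X in ptrr X]compA.
rewrite -tensm_compr pq tensm_id compm1 => ->.
by rewrite -compA dual_trace_cyclic // -compA pq compm1.
Qed.

Lemma exchange_tensl A X Y : projective X -> exchange X Y -> exchange (A ⊗ X) Y.
Proof. by move=> pX exXY f; rewrite tr_tens // ptrl_ptrr exXY -ptrl_tens. Qed.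

Lemma exchange_tensr X Y B : projective Y -> exchange X Y -> exchange X (Y ⊗ B).
Proof.
move=> pY exXY f; rewrite dual_trace_tens // ptrr_tens exXY ptrl_ptrr.
congr (dual_trace _ (ptrr (ptrl _))).
by rewrite !compA assocVK comp1m -compA assocVK compm1.
Qed.

Section Ambidextrous.
Variables (P : C) (projP : projective P) (epi_evP : epi (pev P)).
Hypothesis tr_ambi : left_ambidextrous (tr P).

Lemma exchange_generator : exchange P P^*.
Proof.
move=> f; rewrite -tr_ambi -compA -tr_cyclic //.
  by rewrite -compA phiVK compm1.
exact/projective_dual/projective_dual.
Qed.

(** Since [pev P] is an epimorphism, [X] is a retract of [X ⊗ P^* ⊗ P] and [Y] one
    of [P^* ⊗ (P ⊗ Y)], so that exchange spreads from [P], [P^*] to [X], [Y]. *)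
Lemma exchange_projective X Y : projective X -> projective Y -> exchange X Y.
Proof.
move=> pX pY; have pPd := projective_dual projP.
apply: exchange_retractl pX (projective_retractl epi_evP pX) _.
  exact: projective_tensl.
apply/exchange_tensl => //.
apply: exchange_retractr pY (projective_retractr epi_evP pY) _.
  exact: projective_tensr.
exact/exchange_tensr/exchange_generator.
Qed.

End Ambidextrous.

(** As [P] is a retract of some [Y ⊗ V], the value of the trace on any
    endomorphism of [P] is its value on an endomorphism of [V] obtained by a
    partial trace, hence a multiple of [mdim V]. *)
Lemma mdim_neq0 P V (f : mor P P) : projective P -> tr P f != 0 ->
  class_A V -> mdim tr V != 0.
Proof.
move=> projP tr_f [projV /simpleP [scal _] epi_ev _].
apply: contra_neq tr_f => dV0.
have [p [q pq]] := projective_retractl epi_ev projP.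
have -> : f = p ∘ (q ∘ f) by rewrite compA pq comp1m.
rewrite tr_cyclic //; last exact: projective_tensl.
rewrite tr_tens //; have [a ->] := scal (ptrl (q ∘ f ∘ p)).
by rewrite linearZ /= -/(mdim tr V) dV0 mulr0.
Qed.

Lemma mdim_ddual V : projective V -> mdim tr V^*^* = mdim tr V.
Proof.
move=> pV; rewrite /mdim -phiVK tr_cyclic ?phiK //.
exact/projective_dual/projective_dual.
Qed.

Lemma class_A_dual V : class_A V -> class_A V^*.
Proof.
move=> [pV sV eV etV]; split; first exact: projective_dual.
- exact: simple_dual.
- exact: epi_pev_dual.
- exact: epi_pevt_dual.
Qed.

Lemma dual_traceZ V (a : k) : dual_trace tr (a *: idm V) = a * mdim tr V^*.
Proof. by rewrite /dual_trace dual_morZ dual_mor_id linearZ. Qed.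

(** The idempotent [q ∘ p] on [V ⊗ W] with image [U] has partial traces [a] on [W]
    and [b] on [V].  Write d for [mdim] and d' for the dimension of the dual.  The
    left trace gives d(U) = a d(W), the dual trace gives d'(U) = b d'(V), and
    exchange gives b d(V) = a d'(W); the product formula is what remains when [a]
    and [b] are eliminated. *)
Lemma slope_tens U V W :
  projective U -> projective V -> projective W -> simple V -> simple W ->
  mdim tr U^* != 0 -> mdim tr V^* != 0 -> mdim tr W^* != 0 ->
  exchange V W -> retract U (V ⊗ W) -> slope tr U = slope tr V * slope tr W.
Proof.
move=> pU pV pW /simpleP [scalV _] /simpleP [scalW _] dU dV dW exVW.
move=> [p [q pq]]; have pVW : projective (V ⊗ W) by apply: projective_tensl.
have [a eq_a] := scalW (ptrl (q ∘ p)).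
have [b eq_b] := scalV (ptrr (q ∘ p)).
have eqU : mdim tr U = a * mdim tr W.
  by rewrite /mdim -pq -tr_cyclic // tr_tens // eq_a linearZ.
have eqUd : mdim tr U^* = b * mdim tr V^*.
  rewrite -dual_traceZ -eq_b -dual_trace_tens // dual_trace_cyclic // pq.
  by rewrite /dual_trace dual_mor_id.
have eq_ab : b * mdim tr V = a * mdim tr W^*.
  by rewrite -dual_traceZ -eq_a -exVW eq_b linearZ.
have b_neq0 : b != 0 by apply: contra_neq dU => b0; rewrite eqUd b0 mul0r.
rewrite /slope eqU eqUd.
have -> : mdim tr V = a * mdim tr W^* / b by rewrite -eq_ab mulrAC mulfV // mul1r.
by field; rewrite dV dW b_neq0.
Qed.

End Traces.

Theorem proposition19 (k : fieldType) (C : pivotal_kcategory k)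
    (P : C) (projP : projective P) (epi_evP : epi (pev P))
    (t : {scalar mor P P}) (t_neq0 : exists f : mor P P, t f != 0)
    (t_ambi : left_ambidextrous t)
    (tr : forall X : C, {scalar mor X X}) (tr_left : left_trace tr)
    (tr_P : forall f : mor P P, tr P f = t f) :
  (* the slope is a map from A, which is stable under duality, to k^x *)
  (forall V : C, class_A V -> class_A V^* /\ slope tr V != 0) /\
  (* (a) *)
  (forall V : C, class_A V -> slope tr V^* = (slope tr V)^-1) /\
  (* (b) *)
  (forall U V W : C, class_A U -> class_A V -> class_A W ->
     retract U (V ⊗ W) -> slope tr U = slope tr V * slope tr W) /\
  (* (c) *)
  (forall V : C, class_A V ->
     ((forall f : mor V V, dual_trace tr f = tr V f) <-> slope tr V = 1)).
Proof.
have [f0 f0_neq0] : exists f : mor P P, tr P f != 0.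
  by have [f tf] := t_neq0; exists f; rewrite tr_P.
have tr_ambi : left_ambidextrous (tr P) by move=> f; rewrite !tr_P.
have dim_neq0 V : class_A V -> mdim tr V != 0.
  exact: (mdim_neq0 tr_left projP f0_neq0).
have dimd_neq0 V : class_A V -> mdim tr V^* != 0.
  by move=> /class_A_dual /dim_neq0.
split=> [V AV|].
  split; first exact: class_A_dual.
  by rewrite /slope mulf_neq0 ?invr_eq0; [|exact: dim_neq0|exact: dimd_neq0].
split=> [V [pV _ _ _]|].
  by rewrite /slope (mdim_ddual tr_left) // invf_div.
split=> [U V W AU AV AW|V AV].
  have [pU _ _ _] := AU; have [pV sV _ _] := AV; have [pW sW _ _] := AW.
  apply: (slope_tens tr_left) => //; try exact: dimd_neq0.
  exact: (exchange_projective tr_left projP epi_evP tr_ambi).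
have [_ /simpleP [scal _] _ _] := AV.
(* Both forms are determined by their values at the identity. *)
split=> [/(_ (idm V))|].
  rewrite /dual_trace dual_mor_id -!/(mdim tr _) => eq_dim.
  by rewrite /slope eq_dim divff ?dim_neq0.
move=> slope1 f; have [a ->] := scal f.
rewrite dual_traceZ linearZ /= -/(mdim tr V); congr (_ * _).
by rewrite -[RHS](divfK (dimd_neq0 V AV)) -/(slope tr V) slope1 mul1r.
Qed.
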